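(* Let $A:\mathcal{H}_1\to\mathcal{H}_2$ be a nonzero bounded linear operator between real Hilbert spaces and let $T:\mathcal{H}_2\to\mathcal{H}_2$ be $\rho$-SQNE, where $\rho\ge 0$. Assume that $\operatorname{im}A\cap\operatorname{Fix}T\neq\emptyset$. Let $\mathcal{L}_\sigma\{T\}:\mathcal{H}_1\to\mathcal{H}_1$ be the extrapolated Landweber operator with $\sigma=\tau$, where $$\tau(x):=\begin{cases}\left(\dfrac{\|A\|\cdot\|T(Ax)-Ax\|}{\|A^*(T(Ax)-Ax)\|}\right)^2, & \text{if }Ax\notin\operatorname{Fix}T,\\ 1,&\text{if }Ax\in\operatorname{Fix}T.\end{cases}$$ Then the following statements hold. (i) If $T$ is weakly regular, then $\mathcal{L}_\sigma\{T\}$ is weakly regular. (ii) If $\operatorname{im}A$ is closed, $T$ is boundedly regular and the family $\{\operatorname{im}A,\operatorname{Fix}T\}$ is boundedly regular, then $\mathcal{L}_\sigma\{T\}$ is boundedly regular. (iii) If $\operatorname{im}A$ is closed, $T$ is boundedly linearly regular and the family $\{\operatorname{im}A,\operatorname{Fix}T\}$ is boundedly linearly regular, then $\mathcal{L}_\sigma\{T\}$ is boundedly linearly regular.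
   Context: $\mathcal{H}_1,\mathcal{H}_2$ are real Hilbert spaces; $A^*$ is the adjoint of $A$, $\operatorname{im}A$ its image, $\|A\|$ its operator norm. $\operatorname{Fix}T$ is the fixed point set of $T$, $d(x,C)=\inf_{c\in C}\|x-c\|$, and $\rightharpoonup$ denotes weak convergence. Landweber operator: $\mathcal{L}\{T\}x:=x+\frac{1}{\|A\|^2}A^*(T(Ax)-Ax)$ for $x\in\mathcal{H}_1$. For a function $\sigma:\mathcal{H}_1\to[1,\infty)$ the extrapolated Landweber operator is $\mathcal{L}_\sigma\{T\}x:=x+\sigma(x)(\mathcal{L}\{T\}x-x)$. (Under the hypotheses, $A^*(T(Ax)-Ax)=0$ if and only if $Ax\in\operatorname{Fix}T$, and $\tau\ge1$, so $\tau$ is well defined as such a function.) $\rho$-SQNE ($\rho$-strongly quasi-nonexpansive, $\rho\ge 0$): $T$ (not necessarily linear) has $\operatorname{Fix}T\ne\emptyset$ and $\|Tx-z\|^2\le\|x-z\|^2-\rho\|Tx-x\|^2$ for all $x$ and all $z\in\operatorname{Fix}T$. Regular operators. An operator $U$ on a Hilbert space $\mathcal{H}$ with $\operatorname{Fix}U\neq\emptyset$ is: - weakly regular if for any sequence $\{x_k\}\subseteq\mathcal{H}$ and any $x_\infty\in\mathcal{H}$, whenever a subsequence $x_{n_k}\rightharpoonup x_\infty$ and $Ux_k-x_k\to0$ then $x_\infty\in\operatorname{Fix}U$; - boundedly regular if for every bounded sequence $\{x_k\}$, $\|Ux_k-x_k\|\to0$ implies $d(x_k,\operatorname{Fix}U)\to0$;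 - boundedly linearly regular if for every bounded set $S\subseteq\mathcal{H}$ there is $\delta_S>0$ with $\|Ux-x\|\ge\delta_S\,d(x,\operatorname{Fix}U)$ for every $x\in S$. Regular families of sets. A family $\{C_1,\dots,C_m\}$ of closed convex sets with $C:=\bigcap_iC_i\neq\emptyset$ is: - boundedly regular if for every bounded sequence $\{x_k\}$, $\max_i d(x_k,C_i)\to0$ implies $d(x_k,C)\to0$; - boundedly linearly regular if for every bounded set $S$ there is $\kappa_S>0$ with $d(x,C)\le\kappa_S\max_i d(x,C_i)$ for every $x\in S$. *)

(* Defs.v *)
From HB Require Import structures.
From mathcomp Require Import all_boot all_order all_algebra.
From mathcomp Require Import boolp classical_sets functions reals topology.
From mathcomp Require Import normedtype sequences.

Set Implicit Arguments.
Unset Strict Implicit.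
Unset Printing Implicit Defensive.

Import Order.TTheory GRing.Theory Num.Theory.
Import numFieldTopology.Exports numFieldNormedType.Exports.

Local Open Scope classical_set_scope.
Local Open Scope ring_scope.

HB.mixin Record CompleteNormedModule_isHilbert (R : realType) H
    of CompleteNormedModule R H := {
  inner : {dot H for (idfun : R -> R)};
  inner_normE : forall x : H, inner x x = `|x| ^+ 2
}.

#[short(type="hilbertType")]
HB.structure Definition Hilbert (R : realType) :=
  {H of CompleteNormedModule_isHilbert R H & CompleteNormedModule R H}.

Section HilbertSpaces.
Context {R : realType}.

Definition weakly_converges {H : hilbertType R} (x : nat -> H) (l : H) : Prop :=
  forall y : H, inner (x k) y @[k --> \oo] --> (inner l y : R).

Definition op_norm {H1 H2 : hilbertType R} (A : H1 -> H2) : R :=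
  sup [set `|A x| | x in [set x | `|x| <= 1]].

(* When A is bounded and linear, the Riesz representation theorem says that
   the set below is a singleton; otherwise the default 0 may be returned. *)
Definition adjoint {H1 H2 : hilbertType R} (A : H1 -> H2) (y : H2) : H1 :=
  xget 0 [set z : H1 | forall x : H1, inner (A x) y = inner x z :> R].

Definition fix_set {H : hilbertType R} (T : H -> H) : set H :=
  [set x | T x = x].

(* A genuine distance only for nonempty C: the infimum of set0 is 0. *)
Definition dist {H : hilbertType R} (x : H) (C : set H) : R :=
  inf [set `|x - c| | c in C].

Definition sqne {H : hilbertType R} (rho : R) (T : H -> H) : Prop :=
  fix_set T !=set0 /\
  forall x z, fix_set T z ->
    `|T x - z| ^+ 2 <= `|x - z| ^+ 2 - rho * `|T x - x| ^+ 2.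

Definition weakly_regular {H : hilbertType R} (U : H -> H) : Prop :=
  fix_set U !=set0 /\
  forall (x : nat -> H) (xoo : H) (n : nat -> nat),
    increasing_seq n -> weakly_converges (x \o n) xoo ->
    U (x k) - x k @[k --> \oo] --> (0 : H) ->
    fix_set U xoo.

Definition boundedly_regular {H : hilbertType R} (U : H -> H) : Prop :=
  fix_set U !=set0 /\
  forall x : nat -> H, bounded_fun x ->
    `|U (x k) - x k| @[k --> \oo] --> (0 : R) ->
    dist (x k) (fix_set U) @[k --> \oo] --> (0 : R).

Definition boundedly_linearly_regular {H : hilbertType R} (U : H -> H) : Prop :=
  fix_set U !=set0 /\
  forall S : set H, bounded_set S ->
    exists2 delta : R, 0 < delta &
      forall x, S x -> delta * dist x (fix_set U) <= `|U x - x|.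

(* Distances are nonnegative, so starting the maximum at 0 is harmless. *)
Definition max_dist {H : hilbertType R} {m : nat} (C : 'I_m -> set H) (x : H)
    : R :=
  \big[Num.max/0]_(i < m) dist x (C i).

(* The next two notions are meant for closed convex sets with a common point. *)
Definition family_boundedly_regular {H : hilbertType R} {m : nat}
    (C : 'I_m -> set H) : Prop :=
  forall x : nat -> H, bounded_fun x ->
    max_dist C (x k) @[k --> \oo] --> (0 : R) ->
    dist (x k) (\bigcap_i C i) @[k --> \oo] --> (0 : R).

Definition family_boundedly_linearly_regular {H : hilbertType R} {m : nat}
    (C : 'I_m -> set H) : Prop :=
  forall S : set H, bounded_set S ->
    exists2 kappa : R, 0 < kappa &
      forall x, S x -> dist x (\bigcap_i C i) <= kappa * max_dist C x.

Definition landweber {H1 H2 : hilbertType R} (A : H1 -> H2) (T : H2 -> H2)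
    (x : H1) : H1 :=
  x + (op_norm A ^+ 2)^-1 *: adjoint A (T (A x) - A x).

Definition extrapolated_landweber {H1 H2 : hilbertType R} (A : H1 -> H2)
    (sigma : H1 -> R) (T : H2 -> H2) (x : H1) : H1 :=
  x + sigma x *: (landweber A T x - x).

Definition tau {H1 H2 : hilbertType R} (A : H1 -> H2) (T : H2 -> H2) (x : H1)
    : R :=
  if `[< fix_set T (A x) >] then 1
  else (op_norm A * `|T (A x) - A x| / `|adjoint A (T (A x) - A x)|) ^+ 2.

End HilbertSpaces.

(* Main.v *)
Require Import Defs.
From HB Require Import structures.
From mathcomp Require Import all_boot all_order all_algebra.
From mathcomp Require Import boolp classical_sets functions reals topology.
From mathcomp Require Import normedtype sequences.
From mathcomp Require Import ring lra.

Import Order.TTheory GRing.Theory Num.Theory.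
Import numFieldTopology.Exports numFieldNormedType.Exports.

Local Open Scope classical_set_scope.
Local Open Scope ring_scope.

(** Write [u = T (A x) - A x] for the residual of [T] at [A x] and [A*] for the
    adjoint.  The factor [tau] cancels [|A|], so that the extrapolated step is
    [L x - x = (|u| / |A* u|)^2 A* u], of length [|u|^2 / |A* u|]
    ([landweber_stepE]).  Two facts about it carry the proof.

    - Expanding [|T y - z|^2 <= |y - z|^2] gives
      [|T y - y|^2 <= 2 <T y - y, z - y>] for every fixed point [z] of [T]
      ([sqne_residual]).  With [y = A x] and [z = A w], which feasibility
      provides, the right-hand side is [2 <A* u, w - x>]; so [A* u = 0] forces
      [u = 0], and the division in [tau] is harmless.  Hence [Fix L] is the
      preimage of [Fix T] under [A] ([fix_landweber]).
    - As [|A* u| <= |A| |u|], the step dominates the residual: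
      [|u| <= |A| |L x - x|] ([residual_le_step]).

    For weak regularity this is enough: small steps give small residuals, and
    [A] preserves weak convergence because it has an adjoint.  The two bounded
    notions also need distances in the domain to be controlled by distances in
    the codomain,
    [d (x, A^-1 C) <= K d (A x, im A :&: C)] ([dist_preimage]); then
    [d (x, Fix L) <= K d (A x, im A :&: Fix T)], regularity of the
    family bounds this through [d (A x, Fix T)], regularity of [T] through
    [|u|], and the step dominates [|u|].

    The estimate [dist_preimage] is the open mapping theorem for an operator
    with closed range ([bounded_preimage]): every value [A x] is attained at
    some [w] with [|w| <= K |A x|].  In a Hilbert space it follows from the
    uniform boundedness principle by duality.  The vectors [y] of [im A] with
    [|A* y| <= 1] are weakly bounded, as [<A x, y> = <x, A* y>], hence
    bounded, so [|y| <= K |A* y|] on [im A] ([adjoint_bounded_below]).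
    Therefore [A* (im A)] is closed, and the orthogonal projection of [x] onto
    it is the required [w]. *)

(** * Inner products *)

Section InnerProduct.
Context {R : realType} {H : hilbertType R}.
Implicit Types (x y z : H) (t : R).

Lemma innerC x y : inner x y = inner y x :> R.
Proof. by rewrite (hermC inner) /= expr0 mul1r. Qed.

Lemma innerDl x y z : inner (x + y) z = inner x z + inner y z :> R.
Proof. exact: (linearDl inner). Qed.

Lemma innerBl x y z : inner (x - y) z = inner x z - inner y z :> R.
Proof. exact: (linearBl inner). Qed.

Lemma innerZl t x y : inner (t *: x) y = t * inner x y :> R.
Proof. exact: (linearZl_LR inner). Qed.

Lemma inner0r x : inner x 0 = 0 :> R.
Proof. exact: (linear0r inner). Qed.

Lemma innerDr x y z : inner z (x + y) = inner z x + inner z y :> R.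
Proof. by rewrite !(innerC z) innerDl. Qed.

Lemma innerBr x y z : inner z (x - y) = inner z x - inner z y :> R.
Proof. by rewrite !(innerC z) innerBl. Qed.

Lemma innerZr t x y : inner x (t *: y) = t * inner x y :> R.
Proof. by rewrite !(innerC x) innerZl. Qed.

Lemma sqr_normBZ t x y :
  `|x - t *: y| ^+ 2 = `|x| ^+ 2 - 2 * t * inner x y + t ^+ 2 * `|y| ^+ 2 :> R.
Proof.
rewrite -!inner_normE !innerBl !innerBr !innerZl !innerZr (innerC y x).
by ring.
Qed.

Lemma inner_eq0 x : (forall y, inner x y = 0 :> R) -> x = 0.
Proof.
by move=> /(_ x) /eqP; rewrite inner_normE sqrf_eq0 normr_eq0 => /eqP.
Qed.

(** A nonnegative quadratic polynomial in [t] has a nonpositive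
    discriminant.  Besides Cauchy-Schwarz, which is the case [D = 0], this says
    that an almost nearest point of a subspace is almost an orthogonal
    projection. *)
Lemma inner_quadratic_bound (D : R) x y :
    (forall t, D <= `|x - t *: y| ^+ 2) ->
  inner x y ^+ 2 <= `|y| ^+ 2 * (`|x| ^+ 2 - D).
Proof.
move=> Dmin; have [->|y0] := eqVneq y 0.
  by rewrite inner0r normr0 !expr0n mul0r.
have y2 : 0 < `|y| ^+ 2 by rewrite exprn_gt0 ?normr_gt0.
have := Dmin (inner x y / `|y| ^+ 2); rewrite sqr_normBZ => Dm.
rewrite mulrC -ler_pdivrMr//.
suff -> : inner x y ^+ 2 / `|y| ^+ 2 = 2 * (inner x y / `|y| ^+ 2) * inner x y -
   (inner x y / `|y| ^+ 2) ^+ 2 * `|y| ^+ 2 :> R by lra.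
by field; rewrite normr_eq0.
Qed.

Lemma cauchy_schwarz x y : `|inner x y : R| <= `|x| * `|y|.
Proof.
rewrite -(@ler_pXn2r _ 2)// ?nnegrE ?mulr_ge0// real_normK ?num_real//.
have := @inner_quadratic_bound 0 x y (fun t => sqr_ge0 _).
by rewrite subr0 exprMn mulrC.
Qed.

End InnerProduct.

(** * Orthogonal projection *)

Section Projection.
Context {R : realType} {H : hilbertType R}.
Implicit Types (x y v : H) (V : set H).

(** An error split over the two indices is what both almost orthogonal points
    and preimages of a convergent sequence provide. *)
Lemma cvg_of_dist (u : nat -> H) (e : nat -> R) :
    e n @[n --> \oo] --> (0 : R) -> (forall n m, `|u n - u m| <= e n + e m) ->
  cvg (u n @[n --> \oo]).
Proof.
move=> e0 ue; apply/cauchy_cvgP/cauchy_exP => d d0.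
have [N _ hN] := cvgr0_norm_lt _ e0 _ (divr_gt0 d0 (ltr0Sn R 1)).
exists (u N), N => // n /= Nn; rewrite -ball_normE /=.
have := hN N (leqnn N); have := hN n Nn => /=.
have := ler_norm (e n); have := ler_norm (e N); have := ue N n; lra.
Qed.

Definition linear_subspace V :=
  V 0 /\ forall (t : R) x y, V x -> V y -> V (t *: x + y).

(** Closedness is expressed by sequences because the image under the adjoint,
    to which it is applied, is only known through sequences of preimages. *)
Definition seq_closed V :=
  forall (u : nat -> H) l, (forall n, V (u n)) -> u n @[n --> \oo] --> l -> V l.

(** Take [q] with [|x - q|^2] within [e^2] of its infimum over [V]: the
    functions [t |-> |x - q - t v|^2] cannot go below that infimum. *)
Lemma almost_orthogonal V x (e : R) : 0 < e -> linear_subspace V ->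
  exists2 q, V q & forall v, V v -> `|inner (x - q) v : R| <= `|v| * e.
Proof.
move=> e0 [V0 VD]; pose E := [set `|x - v| ^+ 2 | v in V].
have infE : has_inf E.
  split; first by exists (`|x - 0| ^+ 2), 0.
  by exists 0 => _ [v _ <-]; exact: sqr_ge0.
have [_ [q Vq <-] qmin] := inf_adherent (exprn_gt0 2 e0) infE.
exists q => // v Vv.
rewrite -(@ler_pXn2r _ 2)// ?nnegrE ?mulr_ge0 ?(ltW e0)//.
rewrite real_normK ?num_real// exprMn.
apply: le_trans (inner_quadratic_bound (inf E) _ v _) _.
  move=> t; apply: ge_inf; first by case: infE.
  exists (t *: v + q); first exact: VD.
  by rewrite opprD addrA addrAC.
rewrite ler_wpM2l ?sqr_ge0//; lra.
Qed.

(** The almost orthogonal points for [e = 1 / (n + 1)] form a Cauchy sequence: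
    testing two of them against their difference bounds its norm by the sum of
    the two errors. *)
Lemma orthogonal_projection V x : linear_subspace V -> seq_closed V ->
  exists2 p, V p & forall v, V v -> inner (x - p) v = 0 :> R.
Proof.
move=> sV cV.
have /choice[q qP] : forall n : nat, exists q, V q /\
    forall v, V v -> `|inner (x - q) v : R| <= `|v| * harmonic n.
  move=> n; have [q Vq qn] := almost_orthogonal V x _ (harmonic_gt0 n) sV.
  by exists q.
have VB n m : V (q n - q m).
  rewrite addrC -scaleN1r; apply: sV.2; [exact: (qP m).1|exact: (qP n).1].
have /cvg_ex[p qp] : cvg (q n @[n --> \oo]).
  apply: (cvg_of_dist q _ (@cvg_harmonic R)) => n m.
  have [->|qnm] := eqVneq (q n - q m) 0.
    by rewrite normr0 addr_ge0 ?harmonic_ge0.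
  have n0 : 0 < `|q n - q m| by rewrite normr_gt0.
  rewrite -(ler_pM2l n0) -expr2 -inner_normE.
  have -> : inner (q n - q m) (q n - q m) =
      inner (x - q m) (q n - q m) - inner (x - q n) (q n - q m) :> R.
    rewrite -innerBl; congr (inner _ _).
    by rewrite opprB [RHS]addrC addrA subrK.
  apply: le_trans (ler_norm _) _; apply: le_trans (ler_normB _ _) _.
  by rewrite mulrDr addrC lerD//; [apply: (qP n).2|apply: (qP m).2].
exists p => [|v Vv]; first by apply: cV qp => n; exact: (qP n).1.
have : inner (x - q n) v @[n --> \oo] --> (0 : R).
  apply/norm_cvg0P.
  apply: (@squeeze_cvgr _ _ _ _ (fun=> 0) (fun n => `|v| * harmonic n)).
  - by apply: nearW => n; rewrite normr_ge0 /=; apply: (qP n).2.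
  - exact: cvg_cst.
  - by rewrite -(mulr0 `|v|); apply: cvgMl_tmp; exact: cvg_harmonic.
have : inner (x - q n) v @[n --> \oo] --> (inner (x - p) v : R).
  apply/cvgrPdist_le => e e0.
  have v0 : 0 < `|v| + 1 by rewrite ltr_wpDl.
  have d0 : 0 < e / (`|v| + 1) by rewrite divr_gt0.
  have /cvgrPdist_le/(_ _ d0) := qp.
  apply: filterS => n /= pq.
  rewrite -innerBl (le_trans (cauchy_schwarz _ _))//.
  have -> : x - p - (x - q n) = - (p - q n).
    by rewrite !opprB addrC addrA subrK.
  rewrite normrN (@le_trans _ _ (`|p - q n| * (`|v| + 1)))//.
    by rewrite ler_wpM2l ?lerDl.
  by rewrite -ler_pdivlMr.
by move=> /cvg_unique h /h; apply.
Qed.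

End Projection.

(** * Riesz representation and the adjoint *)

Section Adjoint.
Context {R : realType}.

Lemma bounded_linear_cvg {V W : normedModType R} {A : {linear V -> W}}
    {u : nat -> V} {l : V} :
    bounded_fun_norm A -> u n @[n --> \oo] --> l ->
  A (u n) @[n --> \oo] --> A l.
Proof.
move=> /bounded_funP/bounded_linear_continuous Ac ul.
exact: (continuous_cvg _ (Ac l)).
Qed.

Lemma closed_seq_closed {H : hilbertType R} {V : set H} :
  closed V -> seq_closed V.
Proof. by move=> cV u l Vu; apply: closed_cvg => //; apply: nearW. Qed.

(** If [r] is the component of a vector outside the kernel that is orthogonal
    to the kernel, then [x - (f x / f r) r] lies in the kernel for every [x],
    hence is orthogonal to [r]; this determines [f]. *)
Lemma riesz {H : hilbertType R} (f : {linear H -> R^o}) :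
  bounded_fun_norm f -> exists z : H, forall x : H, f x = inner x z :> R.
Proof.
move=> fb; have [f0|] := pselect (forall x, f x = 0).
  by exists 0 => x; rewrite f0 inner0r.
move=> /existsNP[x0 /eqP fx0].
pose V := [set x | f x = 0].
have sV : linear_subspace V.
  split; first exact: linear0.
  by move=> t x y fx fy; rewrite /V /= linearP fx fy scaler0 addr0.
have cV : seq_closed V.
  move=> u l Vu ul; have := bounded_linear_cvg fb ul.
  under eq_fun do rewrite Vu.
  by move=> /(cvg_unique (@norm_hausdorff R R^o)) /(_ (cvg_cst _)).
have [p Vp pP] := orthogonal_projection V x0 sV cV.
pose r := x0 - p.
have fr : f r != 0 by rewrite linearB [f p]Vp subr0.
have r0 : r != 0 by apply: contra_neq fr => ->; rewrite linear0.
exists ((f r / `|r| ^+ 2) *: r) => x.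
have /pP : V (x - (f x / f r) *: r).
  by rewrite /V /= linearB linearZ /= [_ *: _]divfK// subrr.
rewrite innerBr innerZr inner_normE innerZr (innerC x) => /eqP.
rewrite subr_eq0 => /eqP ->.
by field; rewrite fr normr_eq0.
Qed.

Context {H1 H2 : hilbertType R} {A : {linear H1 -> H2}}.
Hypothesis Ab : bounded_fun_norm A.

Lemma adjointE y x : inner (A x) y = inner x (adjoint A y) :> R.
Proof.
have lf : linear (fun x => inner (A x) y : R^o).
  by move=> t u v; rewrite linearP innerDl innerZl.
pose f : {linear H1 -> R^o} :=
  HB.pack (fun x => inner (A x) y : R^o) (GRing.isLinear.Build _ _ _ _ _ lf).
have [z zP] : exists z : H1, forall x : H1, f x = inner x z :> R.
  apply: riesz => r; have [M AM] := Ab r; exists (M * `|y|) => u ur.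
  by rewrite (le_trans (cauchy_schwarz _ _)) ?ler_wpM2r ?AM.
by rewrite /adjoint; case: xgetP => [_ _ /(_ x)//|/(_ z)]; case.
Qed.

Lemma adjoint_linear : linear (adjoint A).
Proof.
move=> t y z; apply/eqP; rewrite -subr_eq0; apply/eqP/inner_eq0 => x.
by rewrite innerC innerBr innerDr innerZr -!adjointE innerDr innerZr subrr.
Qed.

Lemma adjoint0 : adjoint A 0 = 0.
Proof. by apply/inner_eq0 => x; rewrite innerC -adjointE inner0r. Qed.

Lemma adjointZ t y : adjoint A (t *: y) = t *: adjoint A y.
Proof. by rewrite -[t *: y]addr0 adjoint_linear adjoint0 addr0. Qed.

Lemma adjointB y z : adjoint A (y - z) = adjoint A y - adjoint A z.
Proof. by rewrite addrC -scaleN1r adjoint_linear scaleN1r addrC. Qed.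

Lemma le_op_norm x : `|A x| <= op_norm A * `|x|.
Proof.
have [->|x0] := eqVneq x 0; first by rewrite linear0 !normr0 mulr0.
have nx : 0 < `|x| by rewrite normr_gt0.
rewrite -ler_pdivrMr//; apply: ub_le_sup.
  by have [M AM] := Ab 1; exists M => _ [z /AM ? <-].
exists (`|x|^-1 *: x); last first.
  by rewrite linearZ normrZ gtr0_norm ?invr_gt0// mulrC.
by rewrite /= normrZ gtr0_norm ?invr_gt0// mulVf// gt_eqF.
Qed.

Lemma op_norm_ge0 : 0 <= op_norm A.
Proof.
apply: ub_le_sup; first by have [M AM] := Ab 1; exists M => _ [z /AM ? <-].
by exists 0; rewrite /= ?linear0 ?normr0.
Qed.

Lemma le_adjoint y : `|adjoint A y| <= op_norm A * `|y|.
Proof.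
have [->|v0] := eqVneq (adjoint A y) 0.
  by rewrite normr0 mulr_ge0 ?op_norm_ge0.
have nv : 0 < `|adjoint A y| by rewrite normr_gt0.
rewrite -(ler_pM2l nv) -expr2 -inner_normE -adjointE.
rewrite (le_trans (ler_norm _))// (le_trans (cauchy_schwarz _ _))//.
by rewrite mulrCA mulrA ler_wpM2r ?le_op_norm.
Qed.

End Adjoint.

(** * Operators with closed range *)

Section ClosedRange.
Context {R : realType} {H1 H2 : hilbertType R} {A : {linear H1 -> H2}}.
Hypotheses (Ab : bounded_fun_norm A) (rA : closed (range A)).

Lemma range_linear_subspace : linear_subspace (range A).
Proof.
split=> [|t _ _ [x _ <-] [y _ <-]]; first by exists 0; rewrite ?linear0.
by exists (t *: x + y); rewrite ?linearP.
Qed.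

(** Uniform boundedness applied to the functionals [<-, y>] for [y] in the
    range of [A] with [|A* y| <= 1].  At a point [h] they take the same values
    as at the projection [A x] of [h] onto the range, where they are bounded
    by [|x|]. *)
Lemma adjoint_bounded_below :
  exists2 K : R, 0 < K & forall y, range A y -> `|y| <= K * `|adjoint A y|.
Proof.
pose F := [set f : H2 -> R^o | exists2 y : H2,
  range A y /\ `|adjoint A y| <= 1 & f = (fun h => inner h y)].
have Fb f : F f -> bounded_fun_norm f /\ linear f.
  move=> [y _ ->]; split=> [r|t u v]; last by rewrite innerDl innerZl.
  exists (r * `|y|) => h hr.
  by rewrite (le_trans (cauchy_schwarz _ _)) ?ler_wpM2r.
have Fpw : pointwise_bounded F.
  move=> h; have [_ [x _ <-] hx] :=
    orthogonal_projection _ h range_linear_subspace (closed_seq_closed rA).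
  exists `|x| => f [y [Ay y1] ->].
  have -> : inner h y = inner (A x) y :> R.
    by apply/eqP; rewrite -subr_eq0 -innerBl hx.
  rewrite (adjointE Ab) (le_trans (cauchy_schwarz _ _))//.
  by rewrite -[leRHS]mulr1 ler_wpM2l.
have [M FM] := Banach_Steinhauss Fb Fpw 1.
have M0 : 0 <= M.
  have /FM/(_ 0) : F (fun h => inner h 0).
    exists 0 => //; split; first by exists 0; rewrite ?linear0.
    by rewrite (adjoint0 Ab) normr0.
  by rewrite normr0 => /(_ ler01); apply: le_trans.
(* [M] may be [0], whereas the constant must be positive. *)
exists (M + 1); first by rewrite ltr_wpDl.
move=> y Ay; have [v0|v0] := eqVneq (adjoint A y) 0.
  have -> : y = 0 :> H2.
    move: Ay => [x _ Ax]; apply/eqP; rewrite -normr_eq0 -sqrf_eq0.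
    by rewrite -inner_normE -{1}Ax (adjointE Ab) v0 inner0r.
  by rewrite normr0 mulr_ge0 ?addr_ge0.
have nv : 0 < `|adjoint A y| by rewrite normr_gt0.
have [->|y0] := eqVneq y 0; first by rewrite normr0 mulr_ge0 ?addr_ge0.
have ny : 0 < `|y| by rewrite normr_gt0.
(* Normalize [y] twice: as a functional by [|A* y|], as an argument by [|y|]. *)
pose z := `|adjoint A y|^-1 *: y.
have /FM/(_ (`|y|^-1 *: y)) : F (fun h => inner h z).
  exists z => //; split.
    rewrite /z -[_ *: y]addr0.
    exact: range_linear_subspace.2 Ay range_linear_subspace.1.
  by rewrite (adjointZ Ab) normrZ gtr0_norm ?invr_gt0// mulVf ?gt_eqF.
rewrite normrZ gtr0_norm ?invr_gt0// mulVf ?gt_eqF// => /(_ (lexx _)).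
rewrite innerZl innerZr inner_normE ger0_norm; last first.
  by rewrite !mulr_ge0 ?invr_ge0 ?sqr_ge0.
have -> : `|y|^-1 * (`|adjoint A y|^-1 * `|y| ^+ 2) = `|y| / `|adjoint A y|.
  by field; rewrite !normr_eq0 y0 v0.
rewrite ler_pdivrMr// => /le_trans; apply.
by rewrite ler_wpM2r ?lerDl.
Qed.

(** By [adjoint_bounded_below], preimages in the range of [A] of a convergent
    sequence are Cauchy, and their limit stays in the range. *)
Lemma adjoint_image_closed : seq_closed (adjoint A @` range A).
Proof.
have [K K0 AK] := adjoint_bounded_below.
move=> u l /(_ _)/cid2-/all_sig2[y Ay yu] ul.
have yB n m : `|y n - y m| <= K * `|u n - l| + K * `|u m - l|.
  have := AK (y n - y m); rewrite (adjointB Ab) !yu => /(_ _)/le_trans; apply.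
    have := range_linear_subspace.2 (-1) _ _ (Ay m) (Ay n).
    by rewrite scaleN1r addrC.
  rewrite -mulrDr ler_pM2l// (distrC (u m)).
  exact: ler_distD.
have e0 : K * `|u n - l| @[n --> \oo] --> (0 : R).
  rewrite -(mulr0 K); apply: cvgMl_tmp; apply/norm_cvg0P.
  by apply/subr_cvg0.
have /cvg_ex[z yz] := cvg_of_dist _ _ e0 yB.
exists z; first exact: closed_seq_closed yz.
pose B : {linear H2 -> H1} := HB.pack (adjoint A : H2 -> H1)
  (GRing.isLinear.Build _ _ _ _ _ (adjoint_linear Ab)).
have Bb : bounded_fun_norm B.
  move=> r; exists (op_norm A * r) => x xr.
  by rewrite (le_trans (le_adjoint Ab _)) ?ler_wpM2l ?op_norm_ge0.
have := bounded_linear_cvg Bb yz.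
rewrite (_ : (fun n => B (y n)) = u); last by apply/funext => n; exact: yu.
by move=> /(cvg_unique (@norm_hausdorff _ _)); apply.
Qed.

(** Let [w = A* y] be the projection of [x] onto [A* (range A)].  Then
    [A (x - w)] is orthogonal to [range A], to which it belongs, so it vanishes;
    and [|w|^2 = <A w, y> <= |A x| |y| <= |A x| K |w|]. *)
Lemma bounded_preimage :
  exists2 K : R, 0 < K & forall x, exists2 w, A w = A x & `|w| <= K * `|A x|.
Proof.
have [K K0 AK] := adjoint_bounded_below; exists K => // x.
have sV : linear_subspace (adjoint A @` range A).
  split=> [|t _ _ [x1 Ax1 <-] [x2 Ax2 <-]].
    exists 0; first exact: range_linear_subspace.1.
    exact: adjoint0.
  exists (t *: x1 + x2); first exact: range_linear_subspace.2.
  exact: adjoint_linear.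
have [w [y Ay yw] wP] := orthogonal_projection _ x sV adjoint_image_closed.
have Awx : A w = A x.
  apply/eqP; rewrite eq_sym -subr_eq0 -linearB -normr_eq0 -sqrf_eq0.
  rewrite -inner_normE (adjointE Ab) wP//.
  by exists (A (x - w)) => //; exists (x - w).
exists w => //; have [->|w0] := eqVneq w 0.
  by rewrite normr0 mulr_ge0 ?(ltW K0).
have nw : 0 < `|w| by rewrite normr_gt0.
rewrite -(ler_pM2l nw) -expr2 -inner_normE -{2}yw -(adjointE Ab) Awx.
rewrite (le_trans (ler_norm _))// (le_trans (cauchy_schwarz _ _))//.
by rewrite mulrC mulrA ler_wpM2r// -yw mulrC AK.
Qed.

End ClosedRange.

(** * Distances *)

Section Distance.
Context {R : realType}.

Lemma dist_ge0 {H : hilbertType R} (x : H) (C : set H) : 0 <= dist x C.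
Proof.
have [->|/set0P[c Cc]] := eqVneq C set0; first by rewrite /dist image_set0 inf0.
by apply: lb_le_inf; [exists `|x - c|, c|move=> _ [d _ <-]].
Qed.

Lemma dist_le {H : hilbertType R} (x : H) {C : set H} {c : H} :
  C c -> dist x C <= `|x - c|.
Proof. by move=> Cc; apply: ge_inf; [exists 0 => _ [d _ <-]|exists c]. Qed.

Lemma le_dist {H : hilbertType R} {x : H} {C : set H} {d : R} :
  C !=set0 -> (forall c, C c -> d <= `|x - c|) -> d <= dist x C.
Proof.
move=> [c Cc] dC; apply: lb_le_inf; first by exists `|x - c|, c.
by move=> _ [e Ce <-]; exact: dC.
Qed.

(** For [A z] in [C], a bounded preimage [w] of [A x - A z] moves [x] to the
    point [x - w] of the preimage of [C], at distance at most
    [K |A x - A z|]. *)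
Lemma dist_preimage {H1 H2 : hilbertType R} {A : {linear H1 -> H2}} :
    bounded_fun_norm A -> closed (range A) ->
  exists2 K : R, 0 < K & forall C, range A `&` C !=set0 ->
    forall x, dist x (A @^-1` C) <= K * dist (A x) (range A `&` C).
Proof.
move=> Ab rA; have [K K0 AK] := bounded_preimage Ab rA; exists K => // C AC x.
rewrite -ler_pdivrMl//; apply: le_dist => // _ [[z _ <-] CAz].
have [w Aw wK] := AK (x - z).
rewrite ler_pdivrMl// -linearB (le_trans _ wK)//.
have Cxw : (A @^-1` C) (x - w) by rewrite /= linearB Aw linearB subKr.
by rewrite (le_trans (dist_le x Cxw))// subKr.
Qed.

(** Points of the range are at distance [0] from it, so only the second set
    contributes to the maximum. *)
Lemma max_dist_range {H1 H2 : hilbertType R} (A : {linear H1 -> H2})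
    (C : set H2) x :
  max_dist (tnth [tuple range A; C]) (A x) = dist (A x) C.
Proof.
rewrite /max_dist !big_ord_recl big_ord0 !(tnth_nth set0) /=.
have -> : dist (A x) (range A) = 0.
  apply/eqP; rewrite eq_le dist_ge0 andbT.
  have := @dist_le _ (A x) (range A) (A x).
  by rewrite subrr normr0; apply; exists x.
by rewrite (max_l (dist_ge0 _ _)) (max_r (dist_ge0 _ _)).
Qed.

Lemma bigcap_pair {T : Type} (A B : set T) :
  \bigcap_i tnth [tuple A; B] i = A `&` B.
Proof.
apply/seteqP; split=> [x AB|x [Ax Bx] i _].
  by split; [apply: (AB ord0)|apply: (AB (lift ord0 ord0))].
by case: i => [[|[|//]] ?]; rewrite (tnth_nth A).
Qed.

Lemma cvg0_dominated (K : R) {f g : nat -> R} :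
    (forall n, 0 <= f n <= K * g n) -> g n @[n --> \oo] --> (0 : R) ->
  f n @[n --> \oo] --> (0 : R).
Proof.
move=> fg g0; apply: (@squeeze_cvgr _ _ _ _ (fun=> 0) (fun n => K * g n)).
- exact: nearW.
- exact: cvg_cst.
- by rewrite -(mulr0 K); apply: cvgMl_tmp.
Qed.

End Distance.

(** * The extrapolated Landweber operator *)

Section Landweber.
Context {R : realType} {H1 H2 : hilbertType R}.
Context {A : {linear H1 -> H2}} {T : H2 -> H2} {rho : R}.
Hypotheses (Ab : bounded_fun_norm A) (A_neq0 : exists x : H1, A x != 0).
Hypotheses (rho_ge0 : 0 <= rho) (Tq : sqne rho T).
Hypothesis feasible : range A `&` fix_set T !=set0.

Let L := extrapolated_landweber A (tau A T) T.

Lemma op_norm_gt0 : 0 < op_norm A.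
Proof.
have [x Ax] := A_neq0; rewrite lt_neqAle op_norm_ge0// andbT eq_sym.
apply: contra_neq Ax => A0; apply/eqP; rewrite -normr_le0.
by have := le_op_norm Ab x; rewrite A0 mul0r.
Qed.

(** Expand the square in the definition of quasi-nonexpansiveness along
    [T x - z = (T x - x) - (z - x)].  The residual makes an acute angle with
    every direction towards a fixed point. *)
Lemma sqne_residual x z : fix_set T z ->
  `|T x - x| ^+ 2 <= 2 * inner (T x - x) (z - x) :> R.
Proof.
move=> Tz; have := Tq.2 x z Tz.
have -> : T x - z = (T x - x) - 1 *: (z - x).
  by rewrite scale1r opprB addrA subrK.
rewrite sqr_normBZ (distrC z) => Txz.
have : 0 <= rho * `|T x - x| ^+ 2 by rewrite mulr_ge0 ?sqr_ge0.
lra.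
Qed.

(** By [sqne_residual] at a feasible [A z], the squared residual is at most
    twice the inner product of its image under the adjoint with [z - x]. *)
Lemma adjoint_residual_neq0 x :
  T (A x) != A x -> adjoint A (T (A x) - A x) != 0.
Proof.
move=> Tx; have [_ [[z _ <-] Tz]] := feasible.
apply: contraNneq Tx => v0; rewrite -subr_eq0 -normr_eq0 -sqrf_eq0.
rewrite eq_le sqr_ge0 andbT (le_trans (sqne_residual _ _ Tz))//.
by rewrite -linearB innerC (adjointE Ab) v0 inner0r mulr0.
Qed.

(** The formula also covers [A x] fixed by [T], where both sides are a multiple
    of the adjoint of [0]. *)
Lemma landweber_stepE x : L x - x =
  (`|T (A x) - A x| / `|adjoint A (T (A x) - A x)|) ^+ 2 *:
    adjoint A (T (A x) - A x).
Proof.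
have xK y : x + y - x = y by rewrite addrC addKr.
rewrite /L /extrapolated_landweber /landweber /tau !xK.
case: asboolP => [->|Tx]; first by rewrite subrr adjoint0// !scaler0.
rewrite scalerA; congr (_ *: _).
have v0 := adjoint_residual_neq0 _ (introN eqP Tx).
by field; rewrite normr_eq0 v0 gt_eqF ?op_norm_gt0.
Qed.

(** The step has length [|u|^2 / |A* u|] with [|A* u| <= |A| |u|]: the
    extrapolation undoes the loss of length caused by the adjoint. *)
Lemma residual_le_step x : `|T (A x) - A x| <= op_norm A * `|L x - x|.
Proof.
have [->|Tx] := eqVneq (T (A x)) (A x).
  by rewrite subrr normr0 mulr_ge0 ?op_norm_ge0.
rewrite landweber_stepE; have := le_adjoint Ab (T (A x) - A x).
have := adjoint_residual_neq0 _ Tx; move: Tx; rewrite -subr_eq0.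
move: (T (A x) - A x) => u; rewrite -!normr_gt0 => u0 v0 vu.
rewrite normrZ ger0_norm ?sqr_ge0//.
have -> : (`|u| / `|adjoint A u|) ^+ 2 * `|adjoint A u| =
    `|u| ^+ 2 / `|adjoint A u| by field; rewrite gt_eqF.
by rewrite mulrA ler_pdivlMr// expr2 mulrA [leRHS]mulrC ler_wpM2l.
Qed.

Lemma fix_landweber : fix_set L = A @^-1` fix_set T.
Proof.
(* A vanishing step forces a vanishing residual by [residual_le_step]. *)
apply/seteqP; split=> x /= Lx; apply/eqP; rewrite -subr_eq0.
  by rewrite -normr_le0 (le_trans (residual_le_step x))// Lx subrr normr0 mulr0.
by rewrite landweber_stepE Lx subrr adjoint0// scaler0.
Qed.

Lemma fix_landweber_neq0 : fix_set L !=set0.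
Proof.
by rewrite fix_landweber; have [_ [[z _ <-] Tz]] := feasible; exists z.
Qed.

Lemma landweber_weakly_regular : weakly_regular T -> weakly_regular L.
Proof.
move=> [_ wT]; split; first exact: fix_landweber_neq0.
move=> x xoo n n_incr x_cvg Lx; rewrite fix_landweber.
apply: (wT (A \o x) _ n n_incr) => [y|].
  rewrite (adjointE Ab) /=; under eq_fun do rewrite (adjointE Ab).
  exact: x_cvg.
have /norm_cvg0P Ln := Lx.
apply/norm_cvg0P; apply: (cvg0_dominated (op_norm A) _ Ln) => k.
by rewrite normr_ge0 residual_le_step.
Qed.

Lemma bounded_image {I : Type} {S : set I} {f : I -> H1} :
  [bounded f x | x in S] -> [bounded A (f x) | x in S].
Proof.
move=> /pinfty_ex_gt0[M _ fM]; have [N AN] := Ab M.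
by exists N; split=> [|r Nr x Sx]; [exact: num_real
  |apply: (le_trans (AN _ (fM x Sx))); exact: ltW].
Qed.

Lemma dist_fix_landweber : closed (range A) -> exists2 K : R, 0 < K &
  forall x, dist x (fix_set L) <= K * dist (A x) (range A `&` fix_set T).
Proof.
move=> /(dist_preimage Ab)[K K0 AK]; exists K => // x.
by rewrite fix_landweber AK.
Qed.

Lemma landweber_boundedly_regular :
    closed (range A) -> boundedly_regular T ->
    family_boundedly_regular (tnth [tuple range A; fix_set T]) ->
  boundedly_regular L.
Proof.
move=> rA [_ bT] bF; split; first exact: fix_landweber_neq0.
move=> x xb Lx; have [K _ AK] := dist_fix_landweber rA.
have Axb : bounded_fun (A \o x) by exact: bounded_image xb.
apply: (@cvg0_dominated _ K _
  (fun k => dist (A (x k)) (range A `&` fix_set T))).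
  by move=> k; rewrite dist_ge0 AK.
have := bF _ Axb; rewrite bigcap_pair; apply.
under eq_fun do rewrite /= max_dist_range.
apply: bT Axb _; apply: (cvg0_dominated (op_norm A) _ Lx) => k.
by rewrite normr_ge0 residual_le_step.
Qed.

Lemma landweber_boundedly_linearly_regular :
    closed (range A) -> boundedly_linearly_regular T ->
    family_boundedly_linearly_regular (tnth [tuple range A; fix_set T]) ->
  boundedly_linearly_regular L.
Proof.
move=> rA [_ bT] bF; split; first exact: fix_landweber_neq0.
move=> S Sb; have [K K0 AK] := dist_fix_landweber rA.
have ASb : bounded_set (A @` S).
  have /pinfty_ex_gt0[M _ SM] := bounded_image (f := id) Sb.
  exists M; split=> [|r Mr _ [x Sx <-]]; first exact: num_real.
  exact: le_trans (SM x Sx) (ltW Mr).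
have [delta delta0 Td] := bT _ ASb.
have [kappa kappa0 Fk] := bF _ ASb.
have C0 : 0 < K * kappa * op_norm A by rewrite !mulr_gt0 ?op_norm_gt0.
exists (delta / (K * kappa * op_norm A)) => [|x Sx]; first by rewrite divr_gt0.
have ASx : (A @` S) (A x) by exists x.
have := Fk _ ASx; rewrite bigcap_pair max_dist_range => dF.
rewrite mulrAC ler_pdivrMr// mulrC.
rewrite (le_trans (ler_wpM2r (ltW delta0) (AK x)))//.
rewrite (le_trans (ler_wpM2r (ltW delta0) (ler_wpM2l (ltW K0) dF)))//.
rewrite [leRHS](_ : _ = K * kappa * (op_norm A * `|L x - x|)); last by ring.
rewrite [leLHS](_ : _ = K * kappa * (delta * dist (A x) (fix_set T)));
  last by ring.
apply: ler_wpM2l (le_trans (Td _ ASx) (residual_le_step x)).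
by rewrite ltW ?mulr_gt0.
Qed.

End Landweber.

Theorem corollary5p4 (R : realType) (H1 H2 : hilbertType R)
    (A : {linear H1 -> H2}) (T : H2 -> H2) (rho : R)
    (A_bounded : bounded_fun_norm A)
    (A_neq0 : exists x : H1, A x != 0)
    (rho_ge0 : 0 <= rho)
    (T_sqne : sqne rho T)
    (feasible : range A `&` fix_set T !=set0) :
  let L := extrapolated_landweber A (tau A T) T in
  let F := tnth [tuple range A; fix_set T] in
  [/\ weakly_regular T -> weakly_regular L,
      closed (range A) -> boundedly_regular T ->
        family_boundedly_regular F -> boundedly_regular L
    & closed (range A) -> boundedly_linearly_regular T ->
        family_boundedly_linearly_regular F -> boundedly_linearly_regular L].
Proof.
split.
- exact: (landweber_weakly_regular A_bounded A_neq0 rho_ge0 T_sqne feasible).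
- exact: (landweber_boundedly_regular A_bounded A_neq0 rho_ge0 T_sqne feasible).
- exact: (landweber_boundedly_linearly_regular A_bounded A_neq0 rho_ge0 T_sqne
    feasible).
Qed.
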